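(* Assume $x(0)=x'(0)=0$. If $x(t)\to0$ as $t\to\infty$, then $y_2(t)\to0$ as $t\to\infty$.
   Context: Standing assumptions: $\omega>0$ is a constant; $p\in C^1([0,\infty))$ with $p(t)>0$ and $p'(t)<0$ for all $t\ge0$, $\int_0^\infty p(t)\,dt=\infty$ and $\int_0^\infty p(t)^2\,dt<\infty$; $f\in L^1_{\mathrm{loc}}([0,\infty))$. $x$ denotes the solution of $x''(t)+p(t)x'(t)+\omega^2x(t)=f(t)$, $t\ge0$. Notation: $y_1(t)=\int_0^te^{-\omega^2(t-s)}f(s)\,ds$; $y_2(t)=\int_0^te^{-\omega^2(t-s)}y_1(s)\,ds=\int_0^t(t-s)e^{-\omega^2(t-s)}f(s)\,ds$ (the solution of $y_2'=-\omega^2y_2+y_1$, $y_2(0)=0$). *)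

(* Defs.v *)
From HB Require Import structures.
From mathcomp Require Import all_boot all_order all_algebra.
From mathcomp Require Import all_classical all_reals all_analysis.
Set Implicit Arguments. Unset Strict Implicit. Unset Printing Implicit Defensive.
Import Order.TTheory GRing.Theory Num.Theory.
Import numFieldNormedType.Exports.
Local Open Scope classical_set_scope.
Local Open Scope ring_scope.

Section Defs.
Context {R : realType}.
Notation mu := (@lebesgue_measure R).

Definition C1_on_nonneg_with_deriv (p dp : R -> R) : Prop :=
  {within `[0, +oo[, continuous dp} /\
  (forall t : R, 0 < t -> is_derive t 1 p (dp t)) /\
  (h^-1 * (p h - p 0) @[h --> 0^'+] --> dp 0).

Definition loc_integrable_nonneg (f : R -> R) : Prop :=
  forall T : R, 0 <= T -> mu.-integrable `[0, T] (EFin \o f).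

(* x is the (Caratheodory) solution of x'' + p x' + w^2 x = f on [0,+oo):
   there is a continuous v (= x') with, for all t >= 0,
   x t = x 0 + int_0^t v  and  v t = v 0 + int_0^t (f - p v - w^2 x),
   the latter integrand being integrable on [0,t]. *)
Definition ode_solution (p f : R -> R) (w : R) (x v : R -> R) : Prop :=
  {within `[0, +oo[, continuous v} /\
  forall t : R, 0 <= t ->
    mu.-integrable `[0, t]
       (EFin \o (fun s => f s - p s * v s - w ^+ 2 * x s)) /\
    x t = x 0 + \int[mu]_(s in `[0, t]) v s /\
    v t = v 0 + \int[mu]_(s in `[0, t]) (f s - p s * v s - w ^+ 2 * x s).

Definition y1 (w : R) (f : R -> R) (t : R) : R :=
  \int[mu]_(s in `[0, t]) (expR (- (w ^+ 2 * (t - s))) * f s).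

Definition y2 (w : R) (f : R -> R) (t : R) : R :=
  \int[mu]_(s in `[0, t]) (expR (- (w ^+ 2 * (t - s))) * y1 w f s).

End Defs.

(* Main.v *)
Require Import Defs.
From HB Require Import structures.
From mathcomp Require Import all_boot all_order all_algebra.
From mathcomp Require Import all_classical all_reals all_analysis.
From mathcomp Require Import measurable_realfun ring lra.
Import Order.TTheory GRing.Theory Num.Theory.
Import numFieldNormedType.Exports.
Local Open Scope classical_set_scope.
Local Open Scope ring_scope.

(** Write [E h = y1 w h] for the convolution with [exp (- w^2 t)]. If [P] is a
    primitive of a locally integrable [g], integration by parts gives
    [E g t = P t - exp (- w^2 t) P 0 - w^2 E P t]. Applied to
    [v' = f - p v - w^2 x], to [x' = v] and to [(p x)' = p' x + p v], it yields
    [y1 = v - w^2 x + (w^4 + w^2) E x + p x - w^2 E (p x) - E (p' x)].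
    Here every term but [v] tends to 0: [E] preserves convergence to 0, and
    [E (p' x)] is eventually dominated by [- E (p')] up to an exponentially
    small term, where [E (p')] tends to 0 because [p] converges.
    Hence [y2 = E y1] tends to 0 as well, since [E v = x - w^2 E x]. *)

(** * Local integrability and primitives on the half-line *)

Section LocIntegrable.
Set Implicit Arguments. Unset Strict Implicit.
Context {R : realType}.
Notation mu := (@lebesgue_measure R).
Implicit Types (f g h P Q : R -> R).

(** Integral form of [P' = g], that is, local absolute continuity of [P] with density [g]. As [f] is
    only locally integrable, [v] need not be differentiable everywhere, and its equation is read in
    this sense. *)
Definition primitive_nonneg P g :=
  loc_integrable_nonneg g /\
  forall t, 0 <= t -> P t = P 0 + \int[mu]_(s in `[0, t]) g s.

Lemma loc_integrable_within_continuous h :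
  {within `[0, +oo[, continuous h} -> loc_integrable_nonneg h.
Proof.
move=> ch T T0; apply: continuous_compact_integrable.
  exact: segment_compact.
by apply: continuous_subspaceW ch; exact: subset_itvl.
Qed.

Lemma within_continuous_nonneg h :
  (forall T, 0 <= T -> {within `[0, T], continuous h}) ->
  {within `[0, +oo[, continuous h}.
Proof.
move=> ch; have ch1 t : 0 < t -> {for t, continuous h}.
  move=> t0; have : 0 < t + 1 by rewrite addr_gt0.
  move=> t1; have /(continuous_within_itvP _ t1)[+ _ _] := ch _ (ltW t1).
  by apply; rewrite in_itv/= t0 ltrDl ltr01.
apply/continuous_within_itvcyP; split.
  by move=> t; rewrite in_itv/= andbT => /ch1.
by have /(continuous_within_itvP _ ltr01)[] := ch _ ler01.
Qed.

Lemma primitive_nonneg_continuous P g : primitive_nonneg P g ->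
  {within `[0, +oo[, continuous P}.
Proof.
move=> [ig Pg]; apply: within_continuous_nonneg => T T0.
apply: (@subspace_eq_continuous _ _ _
    (fun t => P 0 + parameterized_integral mu 0 t g)).
  move=> t; rewrite inE/= in_itv/= => /andP[t0 _].
  by rewrite /from_subspace (Pg t).
have /= cg := @parameterized_integral_continuous R 0 T g T0 (ig T T0).
by move=> t; apply: cvgD; [exact: cvg_cst|exact: cg].
Qed.

(** A continuous factor is measurable and bounded on the compact [[0, T]], so multiplying by it
    preserves integrability. *)
Lemma loc_integrableM g Q : loc_integrable_nonneg g ->
  {within `[0, +oo[, continuous Q} ->
  loc_integrable_nonneg (fun t => g t * Q t).
Proof.
move=> ig cQ T T0.
have cQT : {within `[0, T], continuous Q}.
  by apply: continuous_subspaceW cQ; exact: subset_itvl.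
have mQ : measurable_fun `[0, T] Q.
  by apply: subspace_continuous_measurable_fun.
have bQ : [bounded Q t | t in `[0, T]%classic].
  have /compact_bounded[M [_ mrt]] :=
    continuous_compact cQT (@segment_compact _ 0 T).
  by exists M; split; rewrite ?num_real // => ? ? ? ?; exact: mrt.
exact: (integrableMl _ (ig T T0) mQ bQ).
Qed.

Lemma loc_integrableD f g :
  loc_integrable_nonneg f -> loc_integrable_nonneg g ->
  loc_integrable_nonneg (fun t => f t + g t).
Proof. by move=> fi gi T T0; exact: (integrableD _ (fi T T0) (gi T T0)). Qed.

Lemma loc_integrableZ k f : loc_integrable_nonneg f ->
  loc_integrable_nonneg (fun t => k * f t).
Proof. by move=> fi T T0; exact: (integrableZl _ k (fi T T0)). Qed.

End LocIntegrable.

(** * Joint integrability of a product of two functions *)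

Section ProductIntegrable.
Set Implicit Arguments. Unset Strict Implicit.
Context d1 d2 (T1 : measurableType d1) (T2 : measurableType d2) (R : realType).
Variable m1 : {sigma_finite_measure set T1 -> \bar R}.
Variable m2 : {sigma_finite_measure set T2 -> \bar R}.

(** This makes Fubini applicable. By Tonelli it suffices to bound the iterated integral of the
    absolute value, and dropping the indicator leaves the product of the two integrals of [|g|] and
    [|h|]. *)
Lemma integrable_prod_indic (g : T1 -> R) (h : T2 -> R) (A : set (T1 * T2)) :
  measurable A ->
  m1.-integrable setT (EFin \o g) -> m2.-integrable setT (EFin \o h) ->
  (m1 \x m2)%E.-integrable setT
    (fun z : T1 * T2 => (g z.1 * h z.2 * \1_A z)%:E).
Proof.
move=> mA ig ih.
have mg : measurable_fun setT g.
  by apply/measurable_EFinP; exact: (measurable_int m1 ig).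
have mh : measurable_fun setT h.
  by apply/measurable_EFinP; exact: (measurable_int m2 ih).
have mK : measurable_fun setT (fun z : T1 * T2 => (g z.1 * h z.2 * \1_A z)%:E).
  apply/measurable_EFinP; apply: measurable_funM.
    by apply: measurable_funM; exact: measurableT_comp.
  exact: measurable_indic.
apply/(integrable12ltyP m1 m2 mK).
have mngE : measurable_fun setT (fun x => `|g x|%:E).
  by apply/measurable_EFinP; exact: measurableT_comp.
have mnhE : measurable_fun setT (fun x => `|(h x)%:E|%E).
  by apply: measurableT_comp => //; apply/measurable_EFinP.
apply: (@le_lt_trans _ _
    (\int[m1]_x (`|g x|%:E * \int[m2]_y `|(h y)%:E|))%E).
  apply: ge0_le_integral => //.
  - by move=> x _; exact: integral_ge0.
  - apply: (measurable_fun_fubini_tonelli_F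
      (abse \o (fun z : T1 * T2 => (g z.1 * h z.2 * \1_A z)%:E))).
      exact: measurableT_comp.
    by move=> z; exact: abse_ge0.
  - exact: emeasurable_funM.
  - move=> x _; rewrite -ge0_integralZl//.
    apply: ge0_le_integral => //.
    + apply: measurableT_comp => //.
      by apply: (measurableT_comp mK); exact: measurable_pair1.
    + exact: emeasurable_funM.
    + move=> y _; rewrite -EFinM lee_fin !normrM ler_piMr// ?mulr_ge0//.
      by rewrite indicE; case: (_ \in _); rewrite /= ?normr1 ?normr0.
have ihoo : (\int[m2]_y `|(h y)%:E| < +oo)%E by case/integrableP: ih.
have ifin : (\int[m2]_y `|(h y)%:E|)%E \is a fin_num.
  by rewrite ge0_fin_numE// integral_ge0.
have fin_ge0 : (0 <= (fine (\int[m2]_y `|(h y)%:E|))%:E)%E.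
  by rewrite lee_fin fine_ge0// integral_ge0.
rewrite -(fineK ifin) ge0_integralZr// muleC lte_mul_pinfty//.
by case/integrableP: ig.
Qed.

End ProductIntegrable.

(** * Exchanging the order of integration over a triangle *)

Section PrimitiveProduct.
Set Implicit Arguments. Unset Strict Implicit.
Context {R : realType}.
Notation mu := (@lebesgue_measure R).
Implicit Types (f g h P Q : R -> R).

Lemma EFin_Rintegral (D : set R) f : measurable D ->
  mu.-integrable D (EFin \o f) ->
  (\int[mu]_(x in D) f x)%:E = (\int[mu]_(x in D) (f x)%:E)%E.
Proof.
by move=> mD fi; rewrite /Rintegral fineK//; exact: integrable_fin_num.
Qed.

(** Both sides integrate [g x * h y] over the triangle [0 <= y <= x <= t]. *)
Lemma Rintegral_primitive_swap g h t :
  mu.-integrable `[0, t] (EFin \o g) -> mu.-integrable `[0, t] (EFin \o h) ->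
  \int[mu]_(x in `[0, t]) (g x * \int[mu]_(y in `[0, x]) h y) =
  \int[mu]_(y in `[0, t]) (h y * \int[mu]_(x in `]y, t]) g x).
Proof.
move=> ig ih.
set D := `[0, t]%classic.
have mD : measurable D by exact: measurable_itv.
have iG : mu.-integrable setT (EFin \o (g \_ D)).
  rewrite -restrict_EFin.
  exact: (proj1 (@integrable_mkcond _ _ _ mu D _ mD) ig).
have iH : mu.-integrable setT (EFin \o (h \_ D)).
  rewrite -restrict_EFin.
  exact: (proj1 (@integrable_mkcond _ _ _ mu D _ mD) ih).
pose A : set (measurableTypeR R * measurableTypeR R) := [set z | z.2 <= z.1].
have mA : measurable A.
  by rewrite -[A]setTI; exact: measurable_fun_le.
have AE x y : ((x, y) \in A) = (y <= x) by apply/idP/idP; rewrite inE.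
have := Fubini (integrable_prod_indic mA iG iH).
rewrite /Rintegral => FE; congr fine.
rewrite integral_mkcond [RHS]integral_mkcond.
(* Extending [g] and [h] by zero outside [D] turns the left side into an iterated integral over the
   whole plane, the triangle being cut out by the indicator of [A]. *)
transitivity (
  \int[mu]_x \int[mu]_y ((g \_ D) x * (h \_ D) y * \1_A (x, y))%:E)%E.
  apply: eq_integral => x _; rewrite /= !patchE.
  case: ifPn => [|xD]; last first.
    by under eq_integral do rewrite mul0r mul0r; rewrite integral0.
  rewrite /D inE/= in_itv/= => /andP[x0 xt].
  have sx : `[0, x] `<=` D by apply: subset_itvl; rewrite bnd_simp.
  have ihx : mu.-integrable `[0, x] (EFin \o h) by exact: integrableS ih.
  rewrite -RintegralZl// EFin_Rintegral//; last first.
    exact: (integrableZl _ (g x) ihx).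
  rewrite integral_mkcond; apply: eq_integral => y _.
  rewrite /= !patchE indicE.
  have -> : (y \in `[0, x]%classic) = (y \in D) && ((x, y) \in A).
    rewrite AE !mem_setE !in_itv/= -andbA; congr (_ && _).
    by case: (leP y x) => [yx|]; rewrite ?andbF// (le_trans yx xt).
  by case: (y \in D); case: (_ \in A); rewrite /= ?mulr0 ?mul0r ?mulr1.
rewrite FE; apply: eq_integral => y _; rewrite /= !patchE.
case: ifPn => [|yD]; last first.
  by under eq_integral do rewrite mulr0 mul0r; rewrite integral0.
rewrite /D inE/= in_itv/= => /andP[y0 yt].
have sy : `[y, t] `<=` D by apply: subset_itvr; rewrite bnd_simp.
have igy : mu.-integrable `[y, t] (EFin \o g) by exact: integrableS ig.
have sy' : `]y, t] `<=` `[y, t] by apply: subset_itvr; rewrite bnd_simp.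
have igy' : mu.-integrable `]y, t] (EFin \o g) by exact: integrableS igy.
(* The section of the triangle at height [y] is the closed [[y, t]], which differs from []y, t]] by
   a null set. *)
have := Rintegral_itv_obnd_cbnd igy'; rewrite /Rintegral => ->.
rewrite -/(Rintegral mu `[y, t] g).
rewrite -RintegralZl// EFin_Rintegral//; last exact: (integrableZl _ (h y) igy).
rewrite [RHS]integral_mkcond; apply: eq_integral => x _.
rewrite /= !patchE indicE.
have -> : (x \in `[y, t]%classic) = (x \in D) && ((x, y) \in A).
  rewrite AE !mem_setE !in_itv/= andbAC; congr (_ && _).
  by case: (leP y x) => [yx|]; rewrite ?andbF// (le_trans y0 yx).
by case: (x \in D); case: (_ \in A); rewrite /= ?mulr0 ?mul0r ?mulr1// mulrC.
Qed.

End PrimitiveProduct.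

(** * Calculus of locally absolutely continuous functions *)

Section PrimitiveCalculus.
Set Implicit Arguments. Unset Strict Implicit.
Context {R : realType}.
Notation mu := (@lebesgue_measure R).
Implicit Types (f g h P Q : R -> R).

(** In the triangle exchange the inner integrals are [Q x - Q 0] and [P t - P y]; rearranging gives
    the increment of the product, that is, integration by parts. *)
Lemma primitive_nonnegM P g Q h :
  primitive_nonneg P g -> primitive_nonneg Q h ->
  primitive_nonneg (fun t => P t * Q t) (fun t => g t * Q t + h t * P t).
Proof.
move=> pP pQ.
have [ig Pg] := pP; have [ih Qh] := pQ.
have igQ := loc_integrableM ig (primitive_nonneg_continuous pQ).
have ihP := loc_integrableM ih (primitive_nonneg_continuous pP).
split; first exact: loc_integrableD.
move=> t t0.
rewrite RintegralD//; [|exact: igQ|exact: ihP].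
have igt := ig _ t0; have iht := ih _ t0.
have E1 : \int[mu]_(x in `[0, t]) (g x * \int[mu]_(y in `[0, x]) h y) =
    \int[mu]_(x in `[0, t]) (g x * Q x) - (P t - P 0) * Q 0.
  rewrite [P t]Pg// addrAC subrr add0r -RintegralZr// -RintegralB//; first last.
  - exact: (integrableZr _ (Q 0) igt).
  - exact: igQ.
  apply: eq_Rintegral => x; rewrite inE/= in_itv/= => /andP[x0 _].
  by rewrite [Q x]Qh//; ring.
have E2 : \int[mu]_(y in `[0, t]) (h y * \int[mu]_(x in `]y, t]) g x) =
    (Q t - Q 0) * P t - \int[mu]_(x in `[0, t]) (h x * P x).
  rewrite [Q t]Qh// addrAC subrr add0r -RintegralZr// -RintegralB//; first last.
  - exact: ihP.
  - exact: (integrableZr _ (P t) iht).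
  apply: eq_Rintegral => y; rewrite inE/= in_itv/= => /andP[y0 yt].
  rewrite -(@Rintegral_itvB _ g (BLeft 0) (BRight t) y igt) ?bnd_simp//.
  by rewrite [P y]Pg// [P t]Pg//; ring.
by have := Rintegral_primitive_swap igt iht; rewrite E1 E2; lra.
Qed.

(** Fundamental theorem of calculus on [[0, t]]; the degenerate case [t = 0] is treated apart. *)
Lemma primitive_nonneg_derive (p dp : R -> R) :
  {within `[0, +oo[, continuous dp} ->
  (forall t : R, 0 < t -> is_derive t 1 p (dp t)) ->
  p x @[x --> 0^'+] --> p 0 -> primitive_nonneg p dp.
Proof.
move=> cdp dpd cp0; split; first exact: loc_integrable_within_continuous.
move=> t; rewrite le_eqVlt => /predU1P[<-|t0].
  by rewrite set_itv1 Rintegral_set1 addr0.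
have pLR : derivable_oo_LRcontinuous p 0 t.
  split => //; last first.
    apply: cvg_at_left_filter.
    by apply/differentiable_continuous/derivable1_diffP; have [] := dpd _ t0.
  by move=> x; rewrite in_itv/= => /andP[/dpd[]].
have dpE : {in `]0, t[, derive1 p =1 dp}.
  by move=> x; rewrite in_itv/= derive1E => /andP[/dpd[]].
have cdpt : {within `[0, t], continuous dp}.
  by apply: continuous_subspaceW cdp; exact: subset_itvl.
by rewrite /Rintegral (continuous_FTC2 t0 cdpt pLR dpE)/= subrKC.
Qed.

Lemma primitive_nonneg_C1 (p dp : R -> R) : C1_on_nonneg_with_deriv p dp ->
  primitive_nonneg p dp.
Proof.
move=> [cdp [dpd dp0]]; apply: primitive_nonneg_derive => //.
(* Convergence of the difference quotient at 0 yields right continuity there. *)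
have : p 0 + x * (x^-1 * (p x - p 0)) @[x --> 0^'+] --> p 0 + 0 * dp 0.
  apply: cvgD; first exact: cvg_cst.
  by apply: cvgM dp0; apply: cvg_at_right_filter; exact: cvg_id.
rewrite mul0r addr0; apply: cvg_trans; apply: near_eq_cvg; near=> x.
have x0 : 0 < x by near: x; exact: nbhs_right_gt.
by rewrite mulrA divff ?gt_eqF// mul1r addrC subrK.
Unshelve. all: by end_near. Qed.

Lemma primitive_nonneg_expR (a : R) :
  primitive_nonneg (fun t => expR (a * t)) (fun t => a * expR (a * t)).
Proof.
have d (t : R) : is_derive t 1 (fun t : R => expR (a * t)) (a * expR (a * t)).
  by apply: is_derive_eq; rewrite /GRing.scale/= mulr1 mulrC.
have c (t : R) : {for t, continuous (fun t : R => expR (a * t))}.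
  by apply/differentiable_continuous/derivable1_diffP; have [] := d t.
apply: primitive_nonneg_derive => //.
  by apply: continuous_subspaceT => t; apply: cvgM; [exact: cvg_cst|exact: c].
by apply: cvg_at_right_filter; exact: c.
Qed.

End PrimitiveCalculus.

(** * Algebra of convolution with the exponential kernel *)

Section ExponentialAverage.
Set Implicit Arguments. Unset Strict Implicit.
Context {R : realType}.
Notation mu := (@lebesgue_measure R).
Implicit Types (f g h P Q : R -> R).
Variable w : R.

Lemma eq_y1 f g t : (forall s, 0 <= s -> f s = g s) -> y1 w f t = y1 w g t.
Proof.
move=> fg; apply: eq_Rintegral => s; rewrite inE/= in_itv/= => /andP[s0 _].
by rewrite fg.
Qed.

Lemma eq_loc_integrable f g : (forall t, 0 <= t -> f t = g t) ->
  loc_integrable_nonneg f -> loc_integrable_nonneg g.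
Proof.
move=> fg fi T T0; apply: eq_integrable (fi T T0) => //.
by move=> t; rewrite inE/= in_itv/= => /andP[t0 _]; rewrite fg.
Qed.

Lemma loc_integrable_expM f : loc_integrable_nonneg f ->
  loc_integrable_nonneg (fun s => f s * expR (w ^+ 2 * s)).
Proof.
move=> fi; apply: loc_integrableM => //.
exact: primitive_nonneg_continuous (primitive_nonneg_expR _).
Qed.

(** Splitting the exponential frees the integrand of [t], so that linearity and the calculus of
    primitives apply. *)
Lemma y1E f t : loc_integrable_nonneg f -> 0 <= t ->
  y1 w f t = expR (- (w ^+ 2 * t)) *
             \int[mu]_(s in `[0, t]) (f s * expR (w ^+ 2 * s)).
Proof.
move=> fi t0; rewrite -RintegralZl//; last exact: loc_integrable_expM.
apply: eq_Rintegral => s _.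
by rewrite mulrBr opprB addrC expRD -mulrA [f s * _]mulrC.
Qed.

Lemma y1D f g t : loc_integrable_nonneg f -> loc_integrable_nonneg g ->
  0 <= t -> y1 w (fun s => f s + g s) t = y1 w f t + y1 w g t.
Proof.
move=> fi gi t0; rewrite !y1E//; last exact: loc_integrableD.
rewrite -mulrDr -RintegralD//; [|exact: loc_integrable_expM..].
by congr (_ * _); apply: eq_Rintegral => s _; rewrite mulrDl.
Qed.

Lemma y1Z k f t : loc_integrable_nonneg f ->
  0 <= t -> y1 w (fun s => k * f s) t = k * y1 w f t.
Proof.
move=> fi t0; rewrite !y1E//; last exact: loc_integrableZ.
rewrite [RHS]mulrCA -[in RHS]RintegralZl//; last exact: loc_integrable_expM.
by congr (_ * _); apply: eq_Rintegral => s _; rewrite mulrA.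
Qed.

(** By [y1E], the convolution agrees on the half-line with a continuous primitive times an
    exponential. *)
Lemma y1_loc_integrable f : loc_integrable_nonneg f ->
  loc_integrable_nonneg (y1 w f).
Proof.
move=> fi; pose F t := \int[mu]_(s in `[0, t]) (f s * expR (w ^+ 2 * s)).
have pF : primitive_nonneg F (fun s => f s * expR (w ^+ 2 * s)).
  split; first exact: loc_integrable_expM.
  by move=> t t0; rewrite {2}/F set_itv1 Rintegral_set1 add0r.
apply: (@eq_loc_integrable (fun t => F t * expR (- w ^+ 2 * t))).
  by move=> t t0; rewrite y1E// mulrC mulNr.
apply: loc_integrableM.
  apply: loc_integrable_within_continuous.
  exact: primitive_nonneg_continuous pF.
exact: primitive_nonneg_continuous (primitive_nonneg_expR _).
Qed.

(** The product rule for [P s * expR (w ^+ 2 * s)] on [[0, t]], divided by [expR (w ^+ 2 * t)]. *)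
Lemma y1_primitive P g t : primitive_nonneg P g -> 0 <= t ->
  y1 w g t = P t - expR (- (w ^+ 2 * t)) * P 0 - w ^+ 2 * y1 w P t.
Proof.
move=> pP t0; have [gi _] := pP.
have Pi := loc_integrable_within_continuous (primitive_nonneg_continuous pP).
have [_ /(_ t t0)] := primitive_nonnegM pP (primitive_nonneg_expR (w ^+ 2)).
rewrite RintegralD//; last 2 first.
- exact: loc_integrable_expM.
- have ePi := loc_integrableZ (w ^+ 2) (loc_integrable_expM Pi).
  apply: eq_integrable (ePi t t0) => //.
  by move=> s _ /=; congr (_%:E); ring.
rewrite (_ : \int[mu]_(x in `[0, t]) (w ^+ 2 * expR (w ^+ 2 * x) * P x) =
    w ^+ 2 * \int[mu]_(x in `[0, t]) (P x * expR (w ^+ 2 * x))); last first.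
  rewrite -RintegralZl//; last exact: loc_integrable_expM.
  by apply: eq_Rintegral => s _; ring.
rewrite mulr0 expR0 mulr1 !y1E// expRN.
set I := Rintegral _ _ _; set J := Rintegral _ _ _ => E.
have e0 : expR (w ^+ 2 * t) != 0 by rewrite gt_eqF// expR_gt0.
apply: (mulfI e0); rewrite mulVKf//.
rewrite (_ : I = P t * expR (w ^+ 2 * t) - P 0 - w ^+ 2 * J); last first.
  by rewrite E; ring.
by field.
Qed.

(** Before the time [T] from which [g] dominates, [h] contributes a constant times the decaying
    exponential; after it, [g] bounds the integrand. *)
Lemma y1_tail_le h g : loc_integrable_nonneg h -> loc_integrable_nonneg g ->
  (forall t, 0 <= t -> 0 <= g t) ->
  (\forall t \near +oo, `|h t| <= g t) ->
  exists C, \forall t \near +oo,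
    `|y1 w h t| <= expR (- (w ^+ 2 * t)) * C + y1 w g t.
Proof.
move=> hi gi g0 [T0 [_ hg]]; pose T := Num.max T0 0.
have T_ge0 : 0 <= T by rewrite le_max lexx orbT.
exists `|\int[mu]_(s in `[0, T]) (h s * expR (w ^+ 2 * s))|.
near=> t.
have Tt : T <= t by near: t; apply: nbhs_pinfty_ge; rewrite num_real.
have t0 : 0 <= t by exact: le_trans Tt.
rewrite !y1E// -mulrDr normrM ger0_norm ?expR_ge0// ler_wpM2l ?expR_ge0//.
have ih := loc_integrable_expM hi t0.
have ig := loc_integrable_expM gi t0.
(* The interval is open at [T] because the domination is only known for [s > T0]. *)
have sub : `]T, t] `<=` `[0, t] by apply: subset_itvr; rewrite bnd_simp.
have ihT : mu.-integrable `]T, t] (EFin \o (fun s => h s * expR (w ^+ 2 * s))).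
  exact: integrableS ih.
have igT : mu.-integrable `]T, t] (EFin \o (fun s => g s * expR (w ^+ 2 * s))).
  exact: integrableS ig.
have := @Rintegral_itvB _ _ (BLeft 0) (BRight t) T ih.
rewrite !bnd_simp => /(_ T_ge0 Tt) /eqP; rewrite subr_eq addrC => /eqP ->.
rewrite (le_trans (ler_normD _ _))// lerD2l.
rewrite (le_trans (le_normr_Rintegral _ ihT))//.
have := @Rintegral_itvB _ _ (BLeft 0) (BRight t) T ig.
rewrite !bnd_simp => /(_ T_ge0 Tt) /eqP; rewrite subr_eq addrC => /eqP ->.
apply: (@le_trans _ _ (\int[mu]_(s in `]T, t]) (g s * expR (w ^+ 2 * s)))).
  apply: le_Rintegral => //; first exact: integrable_norm.
  move=> s /=; rewrite in_itv/= => /andP[Ts _].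
  rewrite normrM [X in _ * X]ger0_norm ?expR_ge0// ler_wpM2r ?expR_ge0//.
  by apply: hg; rewrite (le_lt_trans _ Ts)// le_max lexx.
(* The integral of [g] over [[0, T]] may be added back, being nonnegative. *)
rewrite lerDr; apply: Rintegral_ge0 => s /=; rewrite in_itv/= => /andP[s0 _].
by rewrite mulr_ge0 ?expR_ge0 ?g0.
Unshelve. all: by end_near. Qed.

(** * Decay of exponential averages *)

Hypothesis w_gt0 : 0 < w.

Lemma cvg_expRN_sqrM : expR (- (w ^+ 2 * t)) @[t --> +oo] --> (0 : R).
Proof.
have w20 : 0 < w ^+ 2 by rewrite exprn_gt0.
exact: (cvg_comp _ _ (gt0_cvgMry w20 cvg_id) (@cvgr_expR R)).
Qed.

Lemma y1_dominated_cvg0 h g : loc_integrable_nonneg h ->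
  loc_integrable_nonneg g -> (forall t, 0 <= t -> 0 <= g t) ->
  (\forall t \near +oo, `|h t| <= g t) ->
  y1 w g t @[t --> +oo] --> 0 -> y1 w h t @[t --> +oo] --> 0.
Proof.
move=> hi gi g0 hg Eg; have [C hC] := y1_tail_le hi gi g0 hg.
apply/cvgr0Pnorm_le => e e0.
have : expR (- (w ^+ 2 * t)) * C + y1 w g t @[t --> +oo] --> 0 * C + 0.
  by apply: cvgD Eg; apply: cvgM cvg_expRN_sqrM _; exact: cvg_cst.
rewrite mul0r addr0 => /cvgr0Pnorm_le /(_ e e0) he.
near=> t; rewrite (le_trans _ (near he t _))//.
by rewrite (le_trans (near hC t _))// ler_norm.
Unshelve. all: by end_near. Qed.

(** Since [c] is a primitive of 0, [y1_primitive] makes [w ^+ 2 * y1 w (fun=> c) t] equal to [c]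
    minus a nonnegative term. *)
Lemma y1_cst_le c t : 0 <= c -> 0 <= t -> y1 w (fun=> c) t <= c / w ^+ 2.
Proof.
move=> c0 t0.
have cst_continuous k : {within `[0, +oo[, continuous (fun _ : R => k : R)}.
  by apply: continuous_subspaceT => x; exact: cvg_cst.
have pc : primitive_nonneg (fun=> c) (fun=> 0).
  split; first exact: loc_integrable_within_continuous.
  by move=> s s0; rewrite Rintegral_cst// mul0r addr0.
have := y1_primitive pc t0.
rewrite {1}/y1; under eq_Rintegral do rewrite mulr0.
rewrite Rintegral_cst// mul0r => E.
rewrite ler_pdivlMr ?exprn_gt0// mulrC.
rewrite (_ : _ * _ = c - expR (- (w ^+ 2 * t)) * c); last by lra.
by rewrite gerBl mulr_ge0 ?expR_ge0.
Qed.

Lemma y1_cvg0 h : loc_integrable_nonneg h -> h t @[t --> +oo] --> 0 ->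
  y1 w h t @[t --> +oo] --> 0.
Proof.
move=> hi h0; apply/cvgr0Pnorm_le => e e0.
have w20 : 0 < w ^+ 2 by rewrite exprn_gt0.
(* With this [c] the bound [c / w ^+ 2] is [e / 2]; the exponential term takes the other half. *)
pose c := e / 2 * w ^+ 2; have c0 : 0 < c by rewrite mulr_gt0// divr_gt0.
have ci : loc_integrable_nonneg (fun=> c).
  apply: loc_integrable_within_continuous.
  by apply: continuous_subspaceT => x; exact: cvg_cst.
have hc : \forall t \near +oo, `|h t| <= c by move/cvgr0Pnorm_le : h0; apply.
have [C hC] := y1_tail_le hi ci (fun _ _ => ltW c0) hc.
have : expR (- (w ^+ 2 * t)) * C @[t --> +oo] --> 0 * C.
  by apply: cvgM cvg_expRN_sqrM _; exact: cvg_cst.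
rewrite mul0r => /cvgr0Pnorm_le /(_ (e / 2)) /(_ (divr_gt0 e0 (ltr0Sn _ 1))) he.
near=> t; have t0 : 0 <= t by near: t; apply: nbhs_pinfty_ge; rewrite num_real.
rewrite (le_trans (near hC t _))// [leRHS](splitr e) lerD//.
  by rewrite (le_trans (ler_norm _))//; exact: (near he t _).
by rewrite (le_trans (y1_cst_le (ltW c0) t0))// /c mulfK// gt_eqF.
Unshelve. all: by end_near. Qed.

End ExponentialAverage.

(** * Convergence of [p] and decay of the average of [dp] *)

Section DecreasingLimit.
Context {R : realType}.

Lemma C1_nonincreasing_cvg (p dp : R -> R) : C1_on_nonneg_with_deriv p dp ->
  (forall t, 0 <= t -> 0 < p t) -> (forall t, 0 <= t -> dp t < 0) ->
  exists l : R, p t @[t --> +oo] --> l.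
Proof.
move=> pC1 p0 dp0; have [_ [dpd _]] := pC1.
have cp := primitive_nonneg_continuous (primitive_nonneg_C1 pC1).
have p_nincr : forall x y, 0 <= x -> x <= y -> p y <= p x.
  apply: ler0_derive1_nincry => //.
    by move=> x; rewrite in_itv/= andbT => /dpd[].
  move=> x; rewrite in_itv/= andbT derive1E => x0.
  by have [_ ->] := dpd x x0; rewrite ltW// dp0// ltW.
(* Negating [p] and freezing it at [p 0] on the negatives gives a function nondecreasing on the
   whole line and bounded above by 0. *)
pose q s := - p (Num.max s 0).
have q_ndecr : {homo q : x y / x <= y}.
  move=> x y xy; rewrite lerN2 p_nincr//; first by rewrite le_max lexx orbT.
  by rewrite ge_max !le_max xy lexx orbT.
have q_ub : has_ubound (range q).
  by exists 0 => _ [s _ <-]; rewrite oppr_le0 ltW// p0// le_max lexx orbT.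
exists (- sup (range q)).
have : - q t @[t --> +oo] --> - sup (range q).
  exact: cvgN (nondecreasing_cvgr q_ndecr q_ub).
apply: cvg_trans; apply: near_eq_cvg; near=> t.
have t0 : 0 <= t by near: t; apply: nbhs_pinfty_ge; rewrite num_real.
by rewrite /q/= opprK max_l.
Unshelve. all: by end_near. Qed.

End DecreasingLimit.

Section Decay.
Set Implicit Arguments. Unset Strict Implicit.
Context {R : realType}.
Notation mu := (@lebesgue_measure R).

(** Since [p - l] is also a primitive of [dp] and tends to 0, every term of [y1_primitive] applied
    to it tends to 0. *)
Lemma y1_deriv_cvg0 (w l : R) (p dp : R -> R) : 0 < w ->
  primitive_nonneg p dp -> p t @[t --> +oo] --> l ->
  y1 w dp t @[t --> +oo] --> 0.
Proof.
move=> w0 [dpi pE] pl; pose q t := p t - l.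
have pq : primitive_nonneg q dp.
  by split => // t t0; rewrite /q pE// addrAC.
have q0 : q t @[t --> +oo] --> 0.
  by rewrite -(subrr l); apply: cvgB => //; exact: cvg_cst.
have qi := loc_integrable_within_continuous (primitive_nonneg_continuous pq).
have : q t - expR (- (w ^+ 2 * t)) * q 0 - w ^+ 2 * y1 w q t @[t --> +oo] -->
    0 - 0 * q 0 - w ^+ 2 * 0.
  apply: cvgB; [apply: cvgB => //; apply: cvgM|apply: cvgM].
  - exact: cvg_expRN_sqrM.
  - exact: cvg_cst.
  - exact: cvg_cst.
  - exact: y1_cvg0.
rewrite mul0r mulr0 !subr0; apply: cvg_trans; apply: near_eq_cvg; near=> t.
have t0 : 0 <= t by near: t; apply: nbhs_pinfty_ge; rewrite num_real.
by rewrite (y1_primitive w pq).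
Unshelve. all: by end_near. Qed.

End Decay.

(** * The identity for [y1] and the passage to [y2] *)

Theorem mainTheorem14 (R : realType) (w : R) (p dp f x v : R -> R) :
  0 < w ->
  C1_on_nonneg_with_deriv p dp ->
  (forall t, 0 <= t -> 0 < p t) ->
  (forall t, 0 <= t -> dp t < 0) ->
  (\int[@lebesgue_measure R]_(t in `[0%R, +oo[%classic) (p t)%:E = +oo)%E ->
  (\int[@lebesgue_measure R]_(t in `[0%R, +oo[%classic) ((p t) ^+ 2)%:E < +oo)%E ->
  loc_integrable_nonneg f ->
  ode_solution p f w x v ->
  x 0 = 0 -> v 0 = 0 ->
  x t @[t --> +oo] --> 0 ->
  y2 w f t @[t --> +oo] --> 0.
Proof.
move=> w0 pC1 p_gt0 dp_lt0 _ _ _ [cv xv] x0 v0 xcvg.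
pose g s := f s - p s * v s - w ^+ 2 * x s.
have pp := primitive_nonneg_C1 pC1; have [dpi _] := pp.
have [l pl] := C1_nonincreasing_cvg pC1 p_gt0 dp_lt0.
have vi := loc_integrable_within_continuous cv.
have pv : primitive_nonneg v g.
  by split=> t t0; have [? []] := xv t t0.
have px : primitive_nonneg x v.
  by split=> // t t0; have [? []] := xv t t0.
have cx := primitive_nonneg_continuous px.
have xi := loc_integrable_within_continuous cx.
have [gi _] := pv.
have fE s : f s = g s + (v s * p s + w ^+ 2 * x s) by rewrite /g; ring.
clearbody g.
have ppx := primitive_nonnegM pp px.
have dpxi := loc_integrableM dpi cx.
have pvi : loc_integrable_nonneg (fun s => v s * p s).
  exact: loc_integrableM (primitive_nonneg_continuous pp).
have pxi : loc_integrable_nonneg (fun s => p s * x s).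
  exact: loc_integrable_within_continuous (primitive_nonneg_continuous ppx).
have Exi := y1_loc_integrable w xi.
have Epxi := y1_loc_integrable w pxi.
have Edpxi := y1_loc_integrable w dpxi.
(* [r] is [y1 w f - v]. The average of [g] gives [v - w^2 x + w^4 E x], that of [v p] gives
   [p x - w^2 E (p x) - E (dp x)], and [w^2 x] gives the remaining [w^2 E x]. Negated coefficients
   replace differences, so that only rules for sums and products are needed. *)
pose r s := - w ^+ 2 * x s + ((w ^+ 2 * w ^+ 2 + w ^+ 2) * y1 w x s +
  (p s * x s + (- w ^+ 2 * y1 w (fun u => p u * x u) s +
  -1 * y1 w (fun u => dp u * x u) s))).
have ri : loc_integrable_nonneg r.
  by do ![apply: loc_integrableD => //|apply: loc_integrableZ => //].
have Ev t : 0 <= t -> y1 w v t = x t - w ^+ 2 * y1 w x t.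
  by move=> t0; rewrite (y1_primitive w px t0) x0 mulr0 subr0.
have y1f t : 0 <= t -> y1 w f t = v t + r t.
  move=> t0.
  have -> : y1 w f t = y1 w (fun s => g s + (v s * p s + w ^+ 2 * x s)) t.
    by apply: eq_y1 => s _.
  have axi := loc_integrableZ (w ^+ 2) xi.
  rewrite y1D//; last exact: loc_integrableD.
  rewrite y1D// y1Z//.
  rewrite (y1_primitive w pv t0) v0 Ev//.
  (* The boundary term [p 0 * x 0] vanishes. *)
  have := y1_primitive w ppx t0; rewrite y1D// x0 /r; lra.
have px0 : p t * x t @[t --> +oo] --> 0.
  by rewrite -(mulr0 l); exact: cvgM.
have Ex0 := y1_cvg0 w0 xi xcvg.
have Epx0 := y1_cvg0 w0 pxi px0.
(* Eventually [|x| <= 1], so [|dp x| <= - dp], and the average of [- dp] tends to 0 because [p]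
   converges. *)
have Edpx0 : y1 w (fun s => dp s * x s) t @[t --> +oo] --> 0.
  apply: (@y1_dominated_cvg0 _ w w0 _ (fun s => -1 * dp s)) => //.
  - exact: loc_integrableZ.
  - by move=> t /dp_lt0 /ltW; rewrite mulN1r oppr_ge0.
  - near=> t; have t0 : 0 <= t.
      by near: t; apply: nbhs_pinfty_ge; rewrite num_real.
    rewrite normrM mulN1r -(ltr0_norm (dp_lt0 t t0)) ler_piMr//.
    by near: t; move/cvgr0_norm_le : xcvg; apply.
  - have : -1 * y1 w dp t @[t --> +oo] --> (-1 * 0 : R).
      by apply: cvgM; [exact: cvg_cst|exact: y1_deriv_cvg0 pl].
    rewrite mulr0; apply: cvg_trans; apply: near_eq_cvg; near=> t.
    by rewrite y1Z//; near: t; apply: nbhs_pinfty_ge; rewrite num_real.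
have r0 : r t @[t --> +oo] --> 0.
  rewrite [X in _ --> X](_ : 0 = - w ^+ 2 * 0 +
    ((w ^+ 2 * w ^+ 2 + w ^+ 2) * 0 + (0 + (- w ^+ 2 * 0 + -1 * 0)))); last by ring.
  by do ![apply: cvgD => //|apply: cvgM => //|exact: cvg_cst].
(* This is [E v + E r], which is [E (y1 w f)], that is, [y2 w f], for [t >= 0]. *)
have : x t - w ^+ 2 * y1 w x t + y1 w r t @[t --> +oo] --> 0 - w ^+ 2 * 0 + 0.
  apply: cvgD; last exact: y1_cvg0.
  by apply: cvgB => //; apply: cvgM => //; exact: cvg_cst.
rewrite mulr0 subr0 addr0; apply: cvg_trans; apply: near_eq_cvg; near=> t.
have t0 : 0 <= t by near: t; apply: nbhs_pinfty_ge; rewrite num_real.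
rewrite -Ev// -y1D//; apply/esym.
by rewrite /y2; exact: (@eq_y1 _ w (y1 w f) _ t y1f).
Unshelve. all: by end_near. Qed.
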